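(* Let $k\geq 1$ be an integer. Let $F_k$ be the simple graph on $4k+4$ vertices whose vertex set is the disjoint union of $\{u\}$, $\{v\}$, $\{x_1,\dots,x_{k+1}\}$, $\{y_1,\dots,y_{k+1}\}$, a set $L$ with $|L|=k$, and a set $R$ with $|R|=k$, and whose edges are exactly: the edge $uv$; for each $i=1,\dots,k+1$ the edges $x_iy_i$, $ux_i$ and $vy_i$; all edges from $u$ to $L$; all edges from $v$ to $R$; and all $k^2$ edges between $L$ and $R$. Let $F_k^-$ be the subgraph of $F_k$ on the same vertex set obtained by deleting the $k^2$ edges between $L$ and $R$ (a copy of $K_{k,k}$). Then $F_k$ and its subgraph $F_k^-$ are cospectral with respect to the normalized Laplacian, i.e. their normalized Laplacian matrices have the same eigenvalues counting multiplicity.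
   Context: For a simple graph with no vertices of degree $0$, adjacency matrix $A$ and diagonal degree matrix $D$, the normalized Laplacian is $\mathcal{L}=D^{-1/2}(D-A)D^{-1/2}$. *)

(* Defs.v *)
From HB Require Import structures.
From mathcomp Require Import all_boot all_order all_algebra.

Set Implicit Arguments.
Unset Strict Implicit.
Unset Printing Implicit Defensive.

Import Order.TTheory GRing.Theory Num.Theory.
Local Open Scope ring_scope.

Record sgraph (T : finType) := SGraph {
  adj :> rel T;
  adj_sym : symmetric adj;
  adj_irrefl : irreflexive adj
}.

Section Graph.
Variables (T : finType) (G : sgraph T).

Definition degree (x : T) : nat := #|[set y | G x y]|.

Fact del_between_sym (A B : {set T}) :
  symmetric [rel x y | G x y &&
    ~~ ((x \in A) && (y \in B) || (x \in B) && (y \in A))].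
Proof.
move=> x y /=; rewrite adj_sym; congr (_ && ~~ _).
by rewrite orbC (andbC (x \in B)) (andbC (x \in A)).
Qed.

Fact del_between_irrefl (A B : {set T}) :
  irreflexive [rel x y | G x y &&
    ~~ ((x \in A) && (y \in B) || (x \in B) && (y \in A))].
Proof. by move=> x /=; rewrite adj_irrefl. Qed.

(* G with all its edges having one end in A and the other in B deleted. *)
Definition del_between (A B : {set T}) : sgraph T :=
  SGraph (del_between_sym A B) (del_between_irrefl A B).

End Graph.

(* Matrices of a graph on T are indexed by 'I_#|T| through enum_val. *)
Section Laplacian.
Variables (R : rcfType) (T : finType) (G : sgraph T).

Definition adj_mx : 'M[R]_#|T| :=
  \matrix_(i, j) (G (enum_val i) (enum_val j))%:R.

Definition deg_mx : 'M[R]_#|T| :=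
  diag_mx (\row_i (degree G (enum_val i))%:R).

(* D^(-1/2). It has this meaning only if G has no vertex of degree 0: in
   Rocq 0^-1 = 0. See F_degree_gt0 and Fminus_degree_gt0 below. *)
Definition deg_mx_invsqrt : 'M[R]_#|T| :=
  diag_mx (\row_i (Num.sqrt (degree G (enum_val i))%:R)^-1).

Definition normalized_laplacian : 'M[R]_#|T| :=
  deg_mx_invsqrt *m (deg_mx - adj_mx) *m deg_mx_invsqrt.

End Laplacian.

(* mup is 0 when a is not an eigenvalue of M. *)
Definition eigen_mult (R : rcfType) (n : nat) (M : 'M[R]_n) (a : R) : nat :=
  mup a (char_poly M).

(* Normalized Laplacians are symmetric, so that all their eigenvalues lie in
   the real closed field R. *)
Definition cospectral (R : rcfType) (T : finType) (G H : sgraph T) : Prop :=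
  forall a : R, eigen_mult (normalized_laplacian R G) a
              = eigen_mult (normalized_laplacian R H) a.

Section Family.
Variable k : nat.

Inductive Fvertex : predArgType :=
  | Vu | Vv
  | Vx of 'I_k.+1 | Vy of 'I_k.+1
  | VL of 'I_k | VR of 'I_k.

Definition Fvertex_code (a : Fvertex) :
    bool + ('I_k.+1 + 'I_k.+1) + ('I_k + 'I_k) :=
  match a with
  | Vu => inl (inl true)
  | Vv => inl (inl false)
  | Vx i => inl (inr (inl i))
  | Vy i => inl (inr (inr i))
  | VL i => inr (inl i)
  | VR i => inr (inr i)
  end.

Definition Fvertex_decode (c : bool + ('I_k.+1 + 'I_k.+1) + ('I_k + 'I_k)) :
    Fvertex :=
  match c with
  | inl (inl true) => Vu
  | inl (inl false) => Vv
  | inl (inr (inl i)) => Vx i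
  | inl (inr (inr i)) => Vy i
  | inr (inl i) => VL i
  | inr (inr i) => VR i
  end.

Fact Fvertex_codeK : cancel Fvertex_code Fvertex_decode.
Proof. by case. Qed.

HB.instance Definition _ := Finite.copy Fvertex (can_type Fvertex_codeK).

Fact card_Fvertex : #|Fvertex| = (4 * k + 4)%N.
Proof.
have decK : cancel Fvertex_decode Fvertex_code by move=> [[[]|[]]|[]].
rewrite (bij_eq_card (Bijective Fvertex_codeK decK)).
rewrite !card_sum card_bool !card_ord !addnn doubleS (mulnDl 2 2) mul2n.
by rewrite !(addSn, addnS) addn0 add0n.
Qed.

(* Each edge of F_k, in one of its two orientations. *)
Definition Farc : rel Fvertex := fun a b =>
  match a, b with
  | Vu, Vv => true
  | Vx i, Vy j => i == j
  | Vu, Vx _ => true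
  | Vv, Vy _ => true
  | Vu, VL _ => true
  | Vv, VR _ => true
  | VL _, VR _ => true
  | _, _ => false
  end.

Fact F_sym : symmetric [rel a b | Farc a b || Farc b a].
Proof. by move=> a b /=; rewrite orbC. Qed.

Fact F_irrefl : irreflexive [rel a b | Farc a b || Farc b a].
Proof. by case. Qed.

Definition F : sgraph Fvertex := SGraph F_sym F_irrefl.

Definition Lset : {set Fvertex} := [set VL i | i : 'I_k].
Definition Rset : {set Fvertex} := [set VR i | i : 'I_k].

Definition Fminus : sgraph Fvertex := del_between F Lset Rset.

Lemma Fminus_degree_gt0 (a : Fvertex) : (0 < degree Fminus a)%N.
Proof.
have nL b : (if b is VL _ then false else true) -> b \in Lset = false.
  by move=> hb; apply/negbTE/imsetP => -[i _ eb]; rewrite eb in hb.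
have nR b : (if b is VR _ then false else true) -> b \in Rset = false.
  by move=> hb; apply/negbTE/imsetP => -[i _ eb]; rewrite eb in hb.
apply/card_gt0P; case: a => [||i|i|i|i];
  [exists Vv | exists Vu | exists Vu | exists Vv | exists Vu | exists Vv];
  by rewrite inE /= ?(nL Vu) ?(nL Vv) ?(nR Vu) ?(nR Vv) ?andbF.
Qed.

Lemma F_degree_gt0 (a : Fvertex) : (0 < degree F a)%N.
Proof.
apply: leq_trans (Fminus_degree_gt0 a) (subset_leq_card _).
by apply/subsetP => b; rewrite !inE => /andP[].
Qed.

End Family.

(* Main.v *)
Require Import Defs.
From HB Require Import structures.
From mathcomp Require Import all_boot all_order all_algebra.
From mathcomp Require Import ring lra.

Set Implicit Arguments.
Unset Strict Implicit.
Unset Printing Implicit Defensive.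

Import Order.TTheory GRing.Theory Num.Theory.
Local Open Scope ring_scope.

(** The normalized Laplacian is similar to [1 - P], where [P = D^-1 A] is the
averaging operator of the random walk ([to_fun_laplacian]). Two graphs on the
same vertices are therefore cospectral as soon as some invertible linear
operator on functions intertwines their operators [P] ([cospectral_transplant]),
and the proof exhibits such an operator, [transplant], from [F k] to [Fminus k].

Both graphs are bipartite with parts [{u} + Y + R] and [{v} + X + L], and both
have the symmetry exchanging [u, X, L] with [v, Y, R]. Functions with zero sum
on [X], [Y], [L], [R] and vanishing at [u], [v] behave alike in the two graphs:
the edges [x_i y_i] give the eigenvalues [1/2] and [-1/2], and [L] and [R] give
the eigenvalue [0]. The functions that are constant on each of the six classes
form a space of dimension 6. There the indicators of the two parts account for
the eigenvalues [1] and [-1]. On what remains, the characteristic polynomial of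
[P] on the symmetric functions is
[q(t) = t^2 - k t / (2 (k+1)) - k / (4 (k+1))] for [F k] and [q(-t)] for
[Fminus k], and the converse holds for the antisymmetric functions. So an
intertwining operator has to exchange symmetric and antisymmetric functions on
that four-dimensional space. Writing a function there by its values on the six
classes, the map
[(u, v, x, y, l, r) |-> (u + 2 y, -v - 2 x, x, -y, -(k+1) l, (k+1) r)]
does so; [transplant] extends it to all functions, fixing the indicators of
the two parts and the deviations from the average on [X] and on [Y]. *)

(** * Similarity and the random walk *)

Lemma char_poly_similar (K : fieldType) (n : nat) (A B S : 'M[K]_n) :
  row_free S -> A *m S = S *m B -> char_poly A = char_poly B.
Proof.
rewrite row_free_unit unitmxE unitfE => nzS AS_SB.
have: char_poly_mx A *m map_mx polyC S = map_mx polyC S *m char_poly_mx B.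
  by rewrite mulmxBl mulmxBr -!map_mxM AS_SB scalar_mxC.
move/(congr1 determinant); rewrite !det_mulmx mulrC => /mulfI; apply.
by rewrite det_map_mx polyC_eq0.
Qed.

Section Walk.
Variables (R : rcfType) (T : finType).
Implicit Types (G H : sgraph T) (f g : {ffun T -> R}) (v : 'rV[R]_#|T|).

Definition walk G f : {ffun T -> R} :=
  [ffun a => (\sum_b (G a b)%:R * f b) / (degree G a)%:R].

(** The change of variables by [D^(-1/2)], and below its inverse: it turns the
symmetric normalized Laplacian into the walk operator. *)
Definition to_fun G v : {ffun T -> R} :=
  [ffun a => v 0 (enum_rank a) / Num.sqrt (degree G a)%:R].

Definition of_fun G f : 'rV[R]_#|T| :=
  \row_j (f (enum_val j) * Num.sqrt (degree G (enum_val j))%:R).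

Lemma sqrt_degree_neq0 G a : (0 < degree G a)%N ->
  Num.sqrt (degree G a)%:R != 0 :> R.
Proof. by move=> dG; rewrite gt_eqF // sqrtr_gt0 ltr0n. Qed.

Lemma to_funK G v : (forall a, (0 < degree G a)%N) -> of_fun G (to_fun G v) = v.
Proof.
move=> dG; apply/rowP => j.
by rewrite mxE ffunE enum_valK divfK // sqrt_degree_neq0.
Qed.

Lemma of_funK G f : (forall a, (0 < degree G a)%N) -> to_fun G (of_fun G f) = f.
Proof.
move=> dG; apply/ffunP => a.
by rewrite ffunE mxE enum_rankK mulfK // sqrt_degree_neq0.
Qed.

(** With [N] the normalized Laplacian, [N D^(-1/2) = D^(-1/2) (1 - A D^-1)], and
on row vectors [v |-> v A D^-1] is the walk operator since [A] is symmetric. *)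
Lemma to_fun_laplacian G v : (forall a, (0 < degree G a)%N) ->
  to_fun G (v *m normalized_laplacian R G) = to_fun G v - walk G (to_fun G v).
Proof.
move=> dG; apply/ffunP => a; rewrite ffunE /normalized_laplacian !mulmxA.
set w := v *m _; have wE b : w 0 (enum_rank b) = to_fun G v b.
  by rewrite /w /deg_mx_invsqrt mul_mx_diag !mxE enum_rankK ffunE.
(* The body of w is forgotten, lest mxE unfold it. *)
move: w wE => w wE.
have nzd := sqrt_degree_neq0 (dG a).
have sqd : (degree G a)%:R = Num.sqrt (degree G a)%:R ^+ 2 :> R.
  by rewrite sqr_sqrtr ?ler0n.
rewrite /deg_mx_invsqrt mul_mx_diag mxE mulmxBr mul_mx_diag !mxE wE.
rewrite enum_rankK !ffunE.
have -> : \sum_j w 0 j * adj_mx R G j (enum_rank a)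
        = \sum_b (G a b)%:R * to_fun G v b.
  rewrite (reindex enum_rank) /=; last first.
    by exists enum_val => i _; [apply: enum_rankK | apply: enum_valK].
  apply: eq_bigr => b _.
  by rewrite wE mulrC mxE !enum_rankK adj_sym.
move: (Num.sqrt _) nzd sqd => s nzs ->; move: (bigop.body _ _ _) => N.
by rewrite expr2 -[LHS]mulrA -invfM mulrBl mulfK // mulf_neq0.
Qed.

(** Linearity is stated pointwise because [{ffun T -> R}] is a module over [R]
only after replacing [R] by its regular module [R^o]. *)
Definition linear_fun (Phi : {ffun T -> R} -> {ffun T -> R}) :=
  forall (c : R) (f g : {ffun T -> R}),
    Phi [ffun a => c * f a + g a] = [ffun a => c * Phi f a + Phi g a].

(** Conjugating [Phi] with the two changes of variables gives a matrix that
intertwines the normalized Laplacians. In finite dimension its injectivity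
makes it invertible. *)
Lemma cospectral_transplant G H (Phi : {ffun T -> R} -> {ffun T -> R}) :
  (forall a, (0 < degree G a)%N) -> (forall a, (0 < degree H a)%N) ->
  linear_fun Phi ->
  (forall f, Phi f =1 (fun=> 0) -> f =1 (fun=> 0)) ->
  (forall f, Phi (walk G f) = walk H (Phi f)) ->
  cospectral R G H.
Proof.
move=> dG dH linPhi injPhi walkPhi a; rewrite /eigen_mult.
have linS : linear (of_fun H \o Phi \o to_fun G).
  move=> c v w; apply/rowP => j; rewrite !mxE /=.
  have -> : to_fun G (c *: v + w)
      = [ffun b => c * to_fun G v b + to_fun G w b].
    by apply/ffunP => b; rewrite !ffunE !mxE mulrDl mulrA.
  by rewrite linPhi ffunE mulrDl mulrA.
pose Sl : {linear _ -> _} := HB.pack (of_fun H \o Phi \o to_fun G)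
  (GRing.isLinear.Build _ _ _ _ _ linS).
pose S := lin1_mx Sl.
have SE v : v *m S = of_fun H (Phi (to_fun G v)) by rewrite mul_rV_lin1.
rewrite (@char_poly_similar _ _ _ (normalized_laplacian R H) S) //.
  apply: inj_row_free => v; rewrite SE => /rowP v0.
  have /injPhi u0 : Phi (to_fun G v) =1 (fun=> 0).
    move=> b; have /eqP := v0 (enum_rank b).
    rewrite !mxE enum_rankK mulf_eq0 (negPf (sqrt_degree_neq0 _)) // orbF.
    by move/eqP.
  by apply/rowP => j; rewrite -[v](to_funK _ dG) !mxE u0 mul0r.
apply/row_matrixP => i; rewrite !rowE 2!mulmxA.
move: (delta_mx _ _) => v; rewrite !SE -[RHS](to_funK _ dH).
rewrite !to_fun_laplacian // of_funK // -walkPhi; congr of_fun.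
have -> : to_fun G v - walk G (to_fun G v)
    = [ffun b => -1 * walk G (to_fun G v) b + to_fun G v b].
  by apply/ffunP => b; rewrite !ffunE mulN1r addrC.
by rewrite linPhi; apply/ffunP => b; rewrite !ffunE mulN1r addrC.
Qed.

Lemma degree_sum G a : (degree G a)%:R = \sum_b (G a b)%:R * 1 :> R.
Proof.
rewrite /degree -sum1dep_card natr_sum big_mkcond /=.
by apply: eq_bigr => b _; case: (G a b); rewrite mulr1.
Qed.

End Walk.

Section Family.
Variables (R : rcfType) (k : nat).
Implicit Types f : {ffun Fvertex k -> R}.

(** * The walks on the two graphs *)

Local Notation n := (1 + k%:R : R).

Lemma big_Fvertex (h : Fvertex k -> R) :
  \sum_b h b = h (Vu k) + h (Vv k) + (\sum_i h (Vx i) + \sum_i h (Vy i))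
             + (\sum_i h (VL i) + \sum_i h (VR i)).
Proof.
rewrite (reindex (@Fvertex_decode k)) /=; last first.
  exists (@Fvertex_code k) => b _; last exact: Fvertex_codeK.
  by case: b => [[[]|[]]|[]].
by rewrite !big_sumType /= big_bool.
Qed.

Lemma FminusE a b : Fminus k a b =
  F k a b && ~~ (match a, b with
                 | VL _, VR _ | VR _, VL _ => true
                 | _, _ => false
                 end).
Proof.
have inL c : (c \in Lset k) = if c is VL _ then true else false.
  by apply/imsetP/idP => [[i _ ->] //|]; case: c => // i _; exists i.
have inR c : (c \in Rset k) = if c is VR _ then true else false.
  by apply/imsetP/idP => [[i _ ->] //|]; case: c => // i _; exists i.
by rewrite /= !inL !inR; case: a b => [||?|?|?|?] [||?|?|?|?].
Qed.

Lemma sum_delta (m : nat) (j : 'I_m) (h : 'I_m -> R) :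
  \sum_i (j == i)%:R * h i = h j.
Proof.
rewrite (bigD1 j) //= eqxx mul1r big1 ?addr0 // => i /negPf.
by rewrite eq_sym => ->; rewrite mul0r.
Qed.

Lemma sum_F (h : Fvertex k -> R) a : \sum_b (F k a b)%:R * h b = match a with
  | Vu => h (Vv k) + \sum_i h (Vx i) + \sum_i h (VL i)
  | Vv => h (Vu k) + \sum_i h (Vy i) + \sum_i h (VR i)
  | Vx i => h (Vu k) + h (Vy i)
  | Vy i => h (Vv k) + h (Vx i)
  | VL i => h (Vu k) + \sum_i h (VR i)
  | VR i => h (Vv k) + \sum_i h (VL i)
  end.
Proof.
have s0 m (g : 'I_m -> R) : \sum_i 0%:R * g i = 0.
  by rewrite -mulr_sumr mul0r.
have s1 m (g : 'I_m -> R) : \sum_i 1%:R * g i = \sum_i g i.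
  by rewrite -mulr_sumr mul1r.
rewrite big_Fvertex; case: a => [||i|i|i|i] /=;
  rewrite ?s0 ?s1 ?mul0r ?mul1r ?add0r ?addr0 //.
- by under eq_bigr do rewrite orbF; rewrite sum_delta.
- by under eq_bigr do rewrite eq_sym; rewrite sum_delta.
Qed.

Lemma sum_Fminus (h : Fvertex k -> R) a :
  \sum_b (Fminus k a b)%:R * h b = match a with
  | Vu => h (Vv k) + \sum_i h (Vx i) + \sum_i h (VL i)
  | Vv => h (Vu k) + \sum_i h (Vy i) + \sum_i h (VR i)
  | Vx i => h (Vu k) + h (Vy i)
  | Vy i => h (Vv k) + h (Vx i)
  | VL i => h (Vu k)
  | VR i => h (Vv k)
  end.
Proof.
under eq_bigr do rewrite FminusE.
(* Deleting the edges between L and R amounts to hiding the values of h on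
   both sets from the vertices of both sets, which have no other edge there. *)
pose inLR (b : Fvertex k) := match b with VL _ | VR _ => true | _ => false end.
pose g b : R := if inLR a && inLR b then 0 else h b.
rewrite (_ : \sum_b _ = \sum_b (F k a b)%:R * g b); last first.
  apply: eq_bigr => b _; rewrite /g {g}.
  by case: a b => [||i|i|i|i] [||j|j|j|j] //=; rewrite ?mulr0 ?mul0r ?andbT.
by rewrite sum_F /g {g}; case: a => [||i|i|i|i] //=; rewrite big1 ?addr0.
Qed.

Lemma sum_one m : \sum_(i < m) 1 = m%:R :> R.
Proof. by rewrite sumr_const card_ord. Qed.

Lemma walk_F f a : walk (F k) f a = match a with
  | Vu => (f (Vv k) + \sum_i f (Vx i) + \sum_i f (VL i)) / (2 * n)
  | Vv => (f (Vu k) + \sum_i f (Vy i) + \sum_i f (VR i)) / (2 * n)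
  | Vx i => (f (Vu k) + f (Vy i)) / 2
  | Vy i => (f (Vv k) + f (Vx i)) / 2
  | VL i => (f (Vu k) + \sum_i f (VR i)) / n
  | VR i => (f (Vv k) + \sum_i f (VL i)) / n
  end :> R.
Proof.
rewrite ffunE degree_sum !sum_F !sum_one.
by case: a => [||i|i|i|i] //; congr (_ / _); ring.
Qed.

Lemma walk_Fminus f a : walk (Fminus k) f a = match a with
  | Vu => (f (Vv k) + \sum_i f (Vx i) + \sum_i f (VL i)) / (2 * n)
  | Vv => (f (Vu k) + \sum_i f (Vy i) + \sum_i f (VR i)) / (2 * n)
  | Vx i => (f (Vu k) + f (Vy i)) / 2
  | Vy i => (f (Vv k) + f (Vx i)) / 2
  | VL i => f (Vu k)
  | VR i => f (Vv k)
  end :> R.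
Proof.
rewrite ffunE degree_sum !sum_Fminus !sum_one.
by case: a => [||i|i|i|i] //; rewrite ?divr1 //; congr (_ / _); ring.
Qed.

(** * The intertwining operator *)

(** The average of [f] over the part [{u} + Y + R] of the bipartite graph
[F k], with the degrees [2n], [2] and [n] as weights; [n] is divided out. *)
Definition avgA f : R :=
  (2 * f (Vu k) + 2 * (\sum_i f (Vy i)) / n + \sum_i f (VR i)) / (k%:R + 4).

(** The same for the other part, [{v} + X + L]. *)
Definition avgB f : R :=
  (2 * f (Vv k) + 2 * (\sum_i f (Vx i)) / n + \sum_i f (VL i)) / (k%:R + 4).

(** The coefficients of [avgA f] and [avgB f] are those for which the
indicators of the two parts are fixed. On [Y] the average changes sign when
[avgA f] is zero, but the deviations from the average are kept: they are kept
on [X], and the edges [x_i y_i], present in both graphs, tie the two together. *)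
Definition transplant f : {ffun Fvertex k -> R} := [ffun b => match b with
  | Vu => f (Vu k) + 2 * (\sum_i f (Vy i)) / n - 2 * avgA f
  | Vy i => f (Vy i) - 2 * (\sum_i f (Vy i)) / n + 2 * avgA f
  | VR i => n * f (VR i) - k%:R * avgA f
  | Vv => - f (Vv k) - 2 * (\sum_i f (Vx i)) / n + 4 * avgB f
  | Vx i => f (Vx i)
  | VL i => - n * f (VL i) + (k%:R + 2) * avgB f
  end : R].

Lemma transplant_is_linear : linear_fun transplant.
Proof.
move=> c f g; apply/ffunP => b; rewrite !ffunE /avgA /avgB !ffunE.
have lin m (e : 'I_m -> Fvertex k) : \sum_i [ffun a => c * f a + g a] (e i)
    = c * (\sum_i f (e i)) + \sum_i g (e i).
  by under eq_bigr do rewrite !ffunE; rewrite big_split mulr_sumr.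
by case: b => [||i|i|i|i]; rewrite ?lin ?ffunE; ring.
Qed.

Lemma sum_affine m (h g : 'I_m -> R) (c d : R) :
  (forall i, h i = c * g i + d) -> \sum_i h i = c * (\sum_i g i) + m%:R * d.
Proof.
move=> hE; under eq_bigr do rewrite hE.
by rewrite big_split -mulr_sumr sumr_const card_ord mulr_natl.
Qed.

Lemma natS_neq0 : n != 0.
Proof. by rewrite nat1r pnatr_eq0. Qed.

Lemma natD4_neq0 : k%:R + 4 != 0 :> R.
Proof. by rewrite -natrD pnatr_eq0 addnC. Qed.

Lemma sum_walk_F f :
  [/\ \sum_i walk (F k) f (Vx i) = (n * f (Vu k) + \sum_i f (Vy i)) / 2,
      \sum_i walk (F k) f (Vy i) = (n * f (Vv k) + \sum_i f (Vx i)) / 2,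
      \sum_i walk (F k) f (VL i) = k%:R * (f (Vu k) + \sum_i f (VR i)) / n &
      \sum_i walk (F k) f (VR i) = k%:R * (f (Vv k) + \sum_i f (VL i)) / n].
Proof.
split.
- rewrite (@sum_affine _ _ (fun i => f (Vy i)) 2^-1 (f (Vu k) / 2)) => [|i].
    by ring.
  by rewrite walk_F; ring.
- rewrite (@sum_affine _ _ (fun i => f (Vx i)) 2^-1 (f (Vv k) / 2)) => [|i].
    by ring.
  by rewrite walk_F; ring.
- under eq_bigr do rewrite walk_F.
  by rewrite sumr_const card_ord -[LHS]mulr_natl mulrA.
- under eq_bigr do rewrite walk_F.
  by rewrite sumr_const card_ord -[LHS]mulr_natl mulrA.
Qed.

Lemma sum_transplant f :
  [/\ \sum_i transplant f (Vx i) = \sum_i f (Vx i),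
      \sum_i transplant f (Vy i) = - (\sum_i f (Vy i)) + 2 * n * avgA f,
      \sum_i transplant f (VL i)
        = - n * (\sum_i f (VL i)) + k%:R * (k%:R + 2) * avgB f &
      \sum_i transplant f (VR i)
        = n * (\sum_i f (VR i)) - k%:R ^+ 2 * avgA f].
Proof.
have nz := natS_neq0.
split.
- by apply: eq_bigr => i _; rewrite ffunE.
- rewrite (@sum_affine _ _ (fun i => f (Vy i)) 1
    (- 2 * (\sum_i f (Vy i)) / n + 2 * avgA f)) => [|i]; first by field.
  by rewrite ffunE; ring.
- rewrite (@sum_affine _ _ (fun i => f (VL i)) (- n)
    ((k%:R + 2) * avgB f)) => [|i]; first by ring.
  by rewrite ffunE; ring.
- rewrite (@sum_affine _ _ (fun i => f (VR i)) n
    (- k%:R * avgA f)) => [|i]; first by ring.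
  by rewrite ffunE; ring.
Qed.

(** The degree weights are stationary for the walk, which moves from each part
to the other. *)
Lemma avg_walk_F f :
  avgA (walk (F k) f) = avgB f /\ avgB (walk (F k) f) = avgA f.
Proof.
have nz := natS_neq0; have nz4 := natD4_neq0.
rewrite /avgA /avgB; have [-> -> -> ->] := sum_walk_F f; rewrite !walk_F.
by split; field; rewrite nz nz4.
Qed.

(** The left-hand sides are the sums of [transplant f] over the two parts
weighted by the degrees [2n], [2] and [1] in [Fminus k], whose total on each
part is [4n + k]: these weighted averages of [transplant f] are the averages
of [f]. *)
Lemma avg_transplant f :
  2 * n * transplant f (Vu k) + 2 * (\sum_i transplant f (Vy i))
    + \sum_i transplant f (VR i) = (4 * n + k%:R) * avgA f /\
  2 * n * transplant f (Vv k) + 2 * (\sum_i transplant f (Vx i))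
    + \sum_i transplant f (VL i) = (4 * n + k%:R) * avgB f.
Proof.
have nz := natS_neq0; have nz4 := natD4_neq0.
have [-> -> -> ->] := sum_transplant f; rewrite !ffunE /avgA /avgB.
by split; field; rewrite nz nz4.
Qed.

(** If [transplant f] vanishes, so do successively [avgA f] and [avgB f], the
sums of [f] over [X] and [Y], and each value of [f]. *)
Lemma transplant_inj f : transplant f =1 (fun=> 0) -> f =1 (fun=> 0).
Proof.
move=> g0; have nz := natS_neq0.
have nzw : 4 * n + k%:R != 0 :> R by rewrite nat1r -natrM -natrD pnatr_eq0.
have s0 m (e : 'I_m -> Fvertex k) : \sum_i transplant f (e i) = 0.
  by rewrite big1.
have [] := avg_transplant f; rewrite !s0 !g0 !mulr0 !addr0.
move=> /esym/eqP; rewrite mulf_eq0 (negPf nzw) => /eqP a0.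
move=> /esym/eqP; rewrite mulf_eq0 (negPf nzw) => /eqP b0.
have [] := sum_transplant f; rewrite !s0 a0 b0 !mulr0 !addr0 subr0.
move=> /esym sx0 /esym/eqP; rewrite oppr_eq0 => /eqP sy0 _ _.
case=> [||i|i|i|i].
- have := g0 (Vu k); rewrite ffunE a0 sy0; lra.
- have := g0 (Vv k); rewrite ffunE b0 sx0; lra.
- by have := g0 (Vx i); rewrite ffunE.
- have := g0 (Vy i); rewrite ffunE a0 sy0; lra.
- have /eqP := g0 (VL i); rewrite ffunE b0 mulr0 addr0 mulf_eq0 oppr_eq0.
  by rewrite (negPf nz) => /eqP.
- have /eqP := g0 (VR i); rewrite ffunE a0 mulr0 subr0 mulf_eq0.
  by rewrite (negPf nz) => /eqP.
Qed.

(** Both sides are linear in the values and class sums of [f], with coefficients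
rational in [k]; they are compared at each of the six kinds of vertices. *)
Lemma transplant_walk f :
  transplant (walk (F k) f) = walk (Fminus k) (transplant f).
Proof.
have nz := natS_neq0; have nz4 := natD4_neq0.
apply/ffunP => a; rewrite walk_Fminus ffunE.
have [-> ->] := avg_walk_F f; have [-> -> _ _] := sum_walk_F f.
have [-> -> -> ->] := sum_transplant f.
by case: a => [||i|i|i|i];
  rewrite ?walk_F ?[transplant f _]ffunE /avgA /avgB; field; rewrite ?nz ?nz4.
Qed.

End Family.

Theorem mainTheorem5 (R : rcfType) (k : nat) (hk : (1 <= k)%N) :
  cospectral R (F k) (Fminus k).
Proof.
exact: (cospectral_transplant (@F_degree_gt0 k) (@Fminus_degree_gt0 k)
  (@transplant_is_linear R k) (@transplant_inj R k) (@transplant_walk R k)).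
Qed.
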